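(* For any number $k$ of graphs, the Simultaneous Spanning Tree problem (SST) can be solved in polynomial time.
   Context: Let $k\ge1$ and let $G_1=(V_1,E_1),\dots,G_k=(V_k,E_k)$ be graphs such that there is a set $\bar V$ with $\bar V=V_i\cap V_j$ for all $i\ne j$ and a graph $\bar G$ with $\bar G=G_i[\bar V]$ for every $i$. A spanning tree of a graph is a maximal acyclic subgraph (a spanning forest; disconnected graphs allowed). SST asks to find an edge set $T\subseteq\bigcup_i E_i$ such that $T\cap E_i$ is a spanning tree of $G_i$ for every $i$, or answer NO if none exists (this is the Simultaneous Minimum Spanning Trees problem with all edge weights equal). *)

(* Defs.v *)
From mathcomp Require Import all_boot all_order all_algebra.

Set Implicit Arguments.
Unset Strict Implicit.
Unset Printing Implicit Defensive.

(* Random access machines in the style of Cook and Reckhow, "Time bounded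
   random access machines" (1973), with cells holding natural numbers and
   truncated subtraction. Every instruction costs one step; as there is no
   multiplication, t steps only produce numbers of O(t + input size) bits, so
   that time is polynomially related to Turing machine time. *)
Inductive instr : Type :=
  | Const of nat & nat          (* Const r c      M[r] := c *)
  | Add of nat & nat & nat      (* Add r a b      M[r] := M[a] + M[b] *)
  | Monus of nat & nat & nat    (* Monus r a b    M[r] := M[a] - M[b] *)
  | Fetch of nat & nat          (* Fetch r a      M[r] := M[M[a]] *)
  | Store of nat & nat          (* Store a r      M[M[a]] := M[r] *)
  | JumpPos of nat & nat        (* JumpPos r l    if M[r] > 0 goto l *)
  | Read of nat                 (* Read r         M[r] := next input word,
                                                  0 once the input is used up *)
  | Write of nat.               (* Write r        output M[r] *)

Definition program := seq instr.

Record config : Type := Config {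
  pc : nat;
  mem : nat -> nat;
  input : seq nat;
  output : seq nat
}.

Definition exec (i : instr) (c : config) : config :=
  let: Config l M inp out := c in
  match i with
  | Const r n => Config l.+1 [eta M with r |-> n] inp out
  | Add r a b => Config l.+1 [eta M with r |-> M a + M b] inp out
  | Monus r a b => Config l.+1 [eta M with r |-> M a - M b] inp out
  | Fetch r a => Config l.+1 [eta M with r |-> M (M a)] inp out
  | Store a r => Config l.+1 [eta M with M a |-> M r] inp out
  | JumpPos r l' => Config (if 0 < M r then l' else l.+1) M inp out
  | Read r => Config l.+1 [eta M with r |-> head 0 inp] (behead inp) out
  | Write r => Config l.+1 M inp (rcons out (M r))
  end.

(* The machine halts when the program counter leaves the program; a halted
   configuration is a fixed point of [step]. *)
Definition step (P : program) (c : config) : config :=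
  if onth P (pc c) is Some i then exec i c else c.

Definition halted (P : program) (c : config) : bool := size P <= pc c.

Definition initial (inp : seq nat) : config := Config 0 (fun=> 0) inp [::].

Definition halts_within (P : program) (inp : seq nat) (t : nat)
    (out : seq nat) : Prop :=
  let c := iter t (step P) (initial inp) in halted P c /\ output c = out.

Definition nbits (n : nat) : nat := (trunc_log 2 n).+1.

Definition bit_size (w : seq nat) : nat := \sum_(n <- w) nbits n.

Record search_problem : Type := SearchProblem {
  instance : Type;
  promise : instance -> Prop;
  candidate : instance -> Type;
  is_solution : forall x : instance, candidate x -> Prop;
  encode_instance : instance -> seq nat;
  encode_candidate : forall x : instance, candidate x -> seq nat
}.

Arguments is_solution : clear implicits.
Arguments encode_candidate : clear implicits.

(* The word [:: 0] is the answer NO; a solution is announced by a leading 1. *)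
Definition correct_answer (Q : search_problem) (x : instance Q)
    (out : seq nat) : Prop :=
  (exists s : candidate x,
     is_solution Q x s /\ out = 1 :: encode_candidate Q x s)
  \/ ((forall s : candidate x, ~ is_solution Q x s) /\ out = [:: 0]).

Definition solvable_in_polynomial_time (Q : search_problem) : Prop :=
  exists (P : program) (p : {poly nat}),
  forall x : instance Q, promise x ->
  exists out : seq nat,
    halts_within P (encode_instance x)
      p.[bit_size (encode_instance x)]%R out
    /\ correct_answer x out.

Record graph (T : finType) : Type := Graph {
  vertices : {set T};
  edges : {set {set T}};
  edgesP : forall e, e \in edges -> e \subset vertices /\ #|e| = 2
}.

(* H = G[V(H)] *)
Definition is_induced (T : finType) (H G : graph T) : Prop :=
  vertices H \subset vertices G
  /\ edges H = [set e in edges G | e \subset vertices H].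

Definition adj (T : finType) (F : {set {set T}}) : rel T :=
  fun u v => [set u; v] \in F.

Definition acyclic (T : finType) (F : {set {set T}}) : Prop :=
  forall c : seq T, 2 < size c -> ~ ucycle (adj F) c.

Definition spanning_tree (T : finType) (G : graph T) (F : {set {set T}}) :
    Prop :=
  [/\ F \subset edges G,
      acyclic F
    & forall F' : {set {set T}},
        F' \subset edges G -> acyclic F' -> F \subset F' -> F' = F].

(* The vertex sets V_1, ..., V_k are subsets of a common set {0, ..., n-1}. *)
Record graph_family : Type := GraphFamily {
  nverts : nat;
  ngraphs : nat;
  graphs : 'I_ngraphs -> graph 'I_nverts
}.

Definition sunflower (x : graph_family) : Prop :=
  exists Gbar : graph 'I_(nverts x),
    (forall i j : 'I_(ngraphs x), i != j ->
       vertices (graphs i) :&: vertices (graphs j) = vertices Gbar)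
    /\ (forall i : 'I_(ngraphs x), is_induced Gbar (graphs i)).

Definition simultaneous_spanning_tree (x : graph_family)
    (T : {set {set 'I_(nverts x)}}) : Prop :=
  T \subset \bigcup_(i < ngraphs x) edges (graphs i)
  /\ forall i : 'I_(ngraphs x),
       spanning_tree (graphs i) (T :&: edges (graphs i)).

(* Row-major n x n adjacency matrix. *)
Definition encode_edges (n : nat) (F : {set {set 'I_n}}) : seq nat :=
  [seq nat_of_bool (adj F u v) | u <- enum 'I_n, v <- enum 'I_n].

Definition encode_graph (n : nat) (G : graph 'I_n) : seq nat :=
  [seq nat_of_bool (v \in vertices G) | v <- enum 'I_n]
  ++ encode_edges (edges G).

Definition encode_family (x : graph_family) : seq nat :=
  [:: nverts x, ngraphs x
    & flatten [seq encode_graph (graphs i) | i <- enum 'I_(ngraphs x)]].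

(* The number of graphs is part of the instance. *)
Definition SST : search_problem := {|
  instance := graph_family;
  promise := fun x => 1 <= ngraphs x /\ sunflower x;
  candidate := fun x => {set {set 'I_(nverts x)}};
  is_solution := simultaneous_spanning_tree;
  encode_instance := encode_family;
  encode_candidate := fun x T => encode_edges T
|}.

(* Main.v *)
(* There is always a solution. An edge lying in two of the graphs lies in all of
   them, so extend one spanning forest F of these shared edges greedily, in each
   graph separately, by edges of that graph alone. The spanning forest of the
   i-th graph obtained in this way is exactly the trace on that graph of the
   union of all of them, because the others meet it in F only. Kruskal's
   algorithm computes the union, keeping track of the components of the current
   forest by labels on the vertices, which are overwritten in linear time when
   two components are merged. *)

Require Import Defs.
From mathcomp Require Import all_boot all_order all_algebra.
From mathcomp Require Import zify.

Set Implicit Arguments.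
Unset Strict Implicit.
Unset Printing Implicit Defensive.

(** * A structured language compiled to random access machines *)

(** Running time is bounded by way of a small language of counted loops. Every loop bound is one of
    two read-only variables, holding the numbers of vertices and of graphs, so a polynomial bound
    can be read off the syntax of a program, while correctness is argued on the functional semantics
    [sem]. Both numbers are at most the input size, because the encoding contains a matrix for each
    graph; only families without vertices, whose matrices are empty, escape this and are answered
    beforehand. The input is a stream that is read once. Instead of storing all the matrices, the
    program condenses them into a single number per vertex pair, which tells a non-edge, an edge of
    exactly one graph, and a shared edge apart. These classes are all that the greedy extension has
    to know. *)

Inductive expr : Type :=
  | Var of nat
  | Cst of nat
  | Plus of expr & expr
  | Minus of expr & expr
  | Elt of nat & expr.

Inductive cmd : Type :=
  | Assign of nat & expr
  | Put of nat & expr & expr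
  | Get of nat
  | Emit of expr
  | Seq of cmd & cmd
  | If of expr & cmd
  | For of nat & nat & cmd.

Record state : Type := State {
  vars : nat -> nat;
  arrs : nat -> nat -> nat;
  inbuf : seq nat;
  outbuf : seq nat
}.

Fixpoint eval (s : state) (e : expr) : nat :=
  match e with
  | Var v => vars s v
  | Cst c => c
  | Plus e1 e2 => eval s e1 + eval s e2
  | Minus e1 e2 => eval s e1 - eval s e2
  | Elt a e1 => arrs s a (eval s e1)
  end.

Definition set_var (v x : nat) (s : state) : state :=
  State [eta vars s with v |-> x] (arrs s) (inbuf s) (outbuf s).

Definition set_elt (a i x : nat) (s : state) : state :=
  State (vars s) (fun b j => if (b == a) && (j == i) then x else arrs s b j)
    (inbuf s) (outbuf s).

(* [For v b c] runs [c] with [v] = 0, ..., b - 1; this is what the compiled code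
   does when [c] assigns neither [v] nor [b], which [cmd_ok] ensures. *)
Fixpoint sem (c : cmd) (s : state) : state :=
  match c with
  | Assign v e => set_var v (eval s e) s
  | Put a e1 e2 => set_elt a (eval s e1) (eval s e2) s
  | Get v => State [eta vars s with v |-> head 0 (inbuf s)] (arrs s)
               (behead (inbuf s)) (outbuf s)
  | Emit e => State (vars s) (arrs s) (inbuf s) (rcons (outbuf s) (eval s e))
  | Seq c1 c2 => sem c2 (sem c1 s)
  | If e c1 => if 0 < eval s e then sem c1 s else s
  | For v b c1 => iter (vars s b)
                    (fun s1 => set_var v (vars s1 v).+1 (sem c1 s1))
                    (set_var v 0 s)
  end.

(** This and the next three functions are syntactic footprints: for concrete commands the side
    conditions of the frame lemmas are settled by computation. *)
Fixpoint assigns (v : nat) (c : cmd) : bool :=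
  match c with
  | Assign w _ | Get w => v == w
  | Put _ _ _ | Emit _ => false
  | Seq c1 c2 => assigns v c1 || assigns v c2
  | If _ c1 => assigns v c1
  | For w _ c1 => (v == w) || assigns v c1
  end.

Fixpoint puts (a : nat) (c : cmd) : bool :=
  match c with
  | Put b _ _ => a == b
  | Assign _ _ | Get _ | Emit _ => false
  | Seq c1 c2 => puts a c1 || puts a c2
  | If _ c1 | For _ _ c1 => puts a c1
  end.

Fixpoint gets (c : cmd) : bool :=
  match c with
  | Get _ => true
  | Assign _ _ | Put _ _ _ | Emit _ => false
  | Seq c1 c2 => gets c1 || gets c2
  | If _ c1 | For _ _ c1 => gets c1
  end.

Fixpoint emits (c : cmd) : bool :=
  match c with
  | Emit _ => true
  | Assign _ _ | Put _ _ _ | Get _ => false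
  | Seq c1 c2 => emits c1 || emits c2
  | If _ c1 | For _ _ c1 => emits c1
  end.

(** * Frame and loop rules *)

Lemma iter_invariant (T R : Type) (g : T -> R) (f : T -> T) n x :
  (forall y, g (f y) = g y) -> g (iter n f x) = g x.
Proof. by move=> gf; elim: n => //= n IHn; rewrite gf. Qed.

Lemma vars_sem v c s : ~~ assigns v c -> vars (sem c s) v = vars s v.
Proof.
elim: c s => //=.
- by move=> w e s /negbTE->.
- by move=> w s /negbTE->.
- by move=> c1 IH1 c2 IH2 s; rewrite negb_or => /andP[? ?]; rewrite IH2 ?IH1.
- by move=> e c1 IH1 s ?; case: ifP => // _; rewrite IH1.
- move=> w b c1 IH1 s; rewrite negb_or => /andP[/negbTE vw ?].
  by rewrite (@iter_invariant _ _ (vars^~ v)) /= vw // => s1; rewrite IH1.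
Qed.

Lemma arrs_sem a c s : ~~ puts a c -> arrs (sem c s) a = arrs s a.
Proof.
elim: c s => //=.
- move=> b e1 e2 s /negbTE ab; by rewrite ab.
- by move=> c1 IH1 c2 IH2 s; rewrite negb_or => /andP[? ?]; rewrite IH2 ?IH1.
- by move=> e c1 IH1 s ?; case: ifP => // _; rewrite IH1.
- move=> w b c1 IH1 s ?.
  by rewrite (@iter_invariant _ _ (arrs^~ a)) // => s1 /=; rewrite IH1.
Qed.

Lemma inbuf_sem c s : ~~ gets c -> inbuf (sem c s) = inbuf s.
Proof.
elim: c s => //=.
- by move=> c1 IH1 c2 IH2 s; rewrite negb_or => /andP[? ?]; rewrite IH2 ?IH1.
- by move=> e c1 IH1 s ?; case: ifP => // _; rewrite IH1.
- move=> w b c1 IH1 s ?.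
  by rewrite (@iter_invariant _ _ inbuf) // => s1 /=; rewrite IH1.
Qed.

Lemma outbuf_sem c s : ~~ emits c -> outbuf (sem c s) = outbuf s.
Proof.
elim: c s => //=.
- by move=> c1 IH1 c2 IH2 s; rewrite negb_or => /andP[? ?]; rewrite IH2 ?IH1.
- by move=> e c1 IH1 s ?; case: ifP => // _; rewrite IH1.
- move=> w b c1 IH1 s ?.
  by rewrite (@iter_invariant _ _ outbuf) // => s1 /=; rewrite IH1.
Qed.

(** The invariant is taken after the update of the counter, which equals the number of completed
    rounds because [c] does not assign it. *)
Lemma sem_For_ind (I : nat -> state -> Prop) v b c s :
    ~~ assigns v c ->
    I 0 (set_var v 0 s) ->
    (forall j s1, j < vars s b -> vars s1 v = j -> I j s1 ->
       I j.+1 (set_var v j.+1 (sem c s1))) ->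
  I (vars s b) (sem (For v b c) s).
Proof.
move=> vc I0 IS /=; set f := fun s1 => _.
suff: forall j, j <= vars s b ->
  vars (iter j f (set_var v 0 s)) v = j /\ I j (iter j f (set_var v 0 s)).
  by move/(_ _ (leqnn _)) => [].
elim=> [|j IHj] lejb /=; first by rewrite eqxx.
have [vj Ij] := IHj (ltnW lejb).
rewrite {1 3}/f vj; split; first by rewrite /= eqxx.
exact: IS.
Qed.

(** * Execution of code inside a program *)

Local Arguments onth : simpl never.

Fixpoint code_at (P : program) (l : nat) (code : program) : Prop :=
  if code is i :: code1 then onth P l = Some i /\ code_at P l.+1 code1
  else True.

Lemma code_at_cat P l c1 c2 :
  code_at P l (c1 ++ c2) <-> code_at P l c1 /\ code_at P (l + size c1) c2.
Proof.
elim: c1 l => [|i c1 IHc] l /=; first by rewrite addn0; split=> [|[]].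
rewrite IHc addnS addSn; split=> [[? []]|[[]]] //.
Qed.

Lemma code_at_self P : code_at P 0 P.
Proof.
(* Generalised to the code of [P] at position [size Q] in [Q ++ P]. *)
rewrite -{1}[P]cat0s -[0]/(size (@nil instr)).
elim: P [::] => //= i P IHP Q; split; first by rewrite onth_cat ltnn subnn.
by rewrite -cat_rcons -(size_rcons Q i); apply: IHP.
Qed.

(** Only an upper bound on the number of steps: skipped branches and shorter loops take less than
    [time] allows. *)
Definition reach (P : program) (t : nat) (c c' : config) : Prop :=
  exists2 t', t' <= t & iter t' (step P) c = c'.

Lemma reach_refl P t c : reach P t c c.
Proof. by exists 0. Qed.

Lemma reach_trans P t1 t2 c1 c2 c3 :
  reach P t1 c1 c2 -> reach P t2 c2 c3 -> reach P (t1 + t2) c1 c3.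
Proof.
move=> [u1 le1 <-] [u2 le2 <-]; exists (u2 + u1); last by rewrite iterD.
by rewrite addnC leq_add.
Qed.

Lemma reach_le P t1 t2 c1 c2 : t1 <= t2 -> reach P t1 c1 c2 -> reach P t2 c1 c2.
Proof. by move=> le12 [u leu <-]; exists u => //; apply: leq_trans le12. Qed.

Lemma reach_step P l M inp out i t c :
    onth P l = Some i -> reach P t (exec i (Config l M inp out)) c ->
  reach P t.+1 (Config l M inp out) c.
Proof.
move=> Pl; rewrite -add1n; apply: reach_trans; exists 1 => //=.
by rewrite /step /= Pl.
Qed.

Ltac run Pl := apply: reach_step Pl _; rewrite /=.

(* Memory layout: variables in the cells below 16, temporaries in the cells
   from 16 to 31, and element i of array a < 8 in cell 32 + 8 * i + a, so that
   the eight arrays are unbounded. *)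
Definition represents (s : state) (M : nat -> nat) : Prop :=
  (forall v, v < 16 -> M v = vars s v) /\
  (forall a i, a < 8 -> M (8 * i + (32 + a)) = arrs s a i).

Lemma represents_temp s M t x : 16 <= t < 32 -> represents s M ->
  represents s [eta M with t |-> x].
Proof.
move=> t_tmp [Mv Ma]; split=> [v v16|a i a8] /=.
  by rewrite ifF ?Mv //; lia.
by rewrite ifF ?Ma //; lia.
Qed.

(** The value goes to the temporary [d], and evaluation touches temporaries from [d] upwards only.
    The bound [d < 31] leaves cell [d.+1] for a second operand or for [address]. *)
Fixpoint expr_ok (e : expr) (d : nat) : bool :=
  [&& 15 < d, d < 31 &
  match e with
  | Var v => v < 16
  | Cst _ => true
  | Plus e1 e2 | Minus e1 e2 => expr_ok e1 d && expr_ok e2 d.+1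
  | Elt a e1 => (a < 8) && expr_ok e1 d
  end].

(** Three doublings stand for the multiplication by 8 of the memory layout. *)
Definition address (a d : nat) : program :=
  [:: Add d d d; Add d d d; Add d d d; Const d.+1 (32 + a); Add d d d.+1].

Fixpoint compile_expr (e : expr) (d : nat) : program :=
  match e with
  | Var v => [:: Const d 0; Add d d v]
  | Cst c => [:: Const d c]
  | Plus e1 e2 => compile_expr e1 d ++ compile_expr e2 d.+1 ++ [:: Add d d d.+1]
  | Minus e1 e2 =>
      compile_expr e1 d ++ compile_expr e2 d.+1 ++ [:: Monus d d d.+1]
  | Elt a e1 => compile_expr e1 d ++ address a d ++ [:: Fetch d d]
  end.

(** The last clause protects the operands that wait in temporaries below [d]. *)
Definition computes (P : program) (s : state) (l t l' d x : nat) : Prop :=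
  forall M inp out, represents s M -> exists M',
  [/\ reach P t (Config l M inp out) (Config l' M' inp out), represents s M',
      M' d = x & forall u, 15 < u < d -> M' u = M u].

Lemma compile_address P s l t l' a d x :
    15 < d < 31 -> code_at P l' (address a d) ->
    computes P s l t l' d x ->
  computes P s l (t + 5) (l' + 5) d (8 * x + (32 + a)).
Proof.
move=> d_ok; rewrite /address /= => -[P0 [P1 [P2 [P3 [P4 _]]]]] cP M inp out sM.
have [M' [red sM' M'd M'u]] := cP M inp out sM.
eexists; split.
- apply: reach_trans red _.
  run P0; run P1; run P2; run P3; run P4.
  by rewrite !addnS addn0; apply: reach_refl.
- by do 5!(apply: represents_temp; first lia).
- by rewrite /= !eqxx M'd; case: eqP => // *; lia.
- by move=> u u_lt /=; rewrite !ifF ?M'u; lia.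
Qed.

Lemma compile_exprP P s e d l :
    expr_ok e d -> code_at P l (compile_expr e d) ->
  computes P s l (size (compile_expr e d)) (l + size (compile_expr e d)) d
    (eval s e).
Proof.
elim: e d l => [v|c|e1 IH1 e2 IH2|e1 IH1 e2 IH2|a e1 IH1] d l.
- move=> /= /and3P[d1 d2 v16] [P0 [P1 _]] M inp out sM; eexists; split.
  + run P0; run P1.
    by rewrite addn2; apply: reach_refl.
  + by do 2!(apply: represents_temp; first lia).
  + by rewrite /= !eqxx ifF; [case: sM => ->|lia].
  + by move=> u u_lt /=; rewrite !ifF; lia.
- move=> /= /and3P[d1 d2 _] [P0 _] M inp out sM; eexists; split.
  + by run P0; rewrite addn1; apply: reach_refl.
  + by apply: represents_temp; first lia.
  + by rewrite /= !eqxx.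
  + by move=> u u_lt /=; rewrite !ifF; lia.
- move=> /= /and4P[d1 d2 ok1 ok2].
  move=> /code_at_cat[P1 /code_at_cat[P2 /= [P3 _]]] M inp out sM.
  have [M1 [red1 sM1 M1d M1u]] := IH1 _ _ ok1 P1 M inp out sM.
  have [M2 [red2 sM2 M2d M2u]] := IH2 _ _ ok2 P2 M1 inp out sM1.
  eexists; split.
  + rewrite !size_cat; apply: (reach_trans red1); apply: (reach_trans red2).
    by run P3; rewrite !addnA addn1; apply: reach_refl.
  + by apply: represents_temp; first lia.
  + by rewrite /= !eqxx M2d M2u ?M1d //; lia.
  + by move=> u u_lt /=; rewrite !ifF ?M2u ?M1u; lia.
- move=> /= /and4P[d1 d2 ok1 ok2].
  move=> /code_at_cat[P1 /code_at_cat[P2 /= [P3 _]]] M inp out sM.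
  have [M1 [red1 sM1 M1d M1u]] := IH1 _ _ ok1 P1 M inp out sM.
  have [M2 [red2 sM2 M2d M2u]] := IH2 _ _ ok2 P2 M1 inp out sM1.
  eexists; split.
  + rewrite !size_cat; apply: (reach_trans red1); apply: (reach_trans red2).
    by run P3; rewrite !addnA addn1; apply: reach_refl.
  + by apply: represents_temp; first lia.
  + by rewrite /= !eqxx M2d M2u ?M1d //; lia.
  + by move=> u u_lt /=; rewrite !ifF ?M2u ?M1u; lia.
- move=> /and4P[d1 d2 a8 ok1] Pl M inp out sM.
  have [P1 /code_at_cat[P2 [P3 _]]] := (code_at_cat _ _ _ _).1 Pl.
  have d_ok: 15 < d < 31 by rewrite d1.
  have [M1 [red1 sM1 M1d M1u]] :=
    compile_address d_ok P2 (IH1 _ _ ok1 P1) inp out sM.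
  eexists; split.
  + rewrite !size_cat !addnA; apply: (reach_trans red1).
    by run P3; rewrite addn1; apply: reach_refl.
  + by apply: represents_temp; first lia.
  + by rewrite /= !eqxx M1d; case: sM1 => _ ->.
  + by move=> u u_lt /=; rewrite !ifF ?M1u; lia.
Qed.

Lemma represents_var s M v x : v < 16 -> represents s M ->
  represents (set_var v x s) [eta M with v |-> x].
Proof.
move=> v16 [Mv Ma]; split=> [w w16|a i a8] /=; first by rewrite Mv.
by rewrite ifF ?Ma //; lia.
Qed.

Lemma represents_elt s M a i x : a < 8 -> represents s M ->
  represents (set_elt a i x s) [eta M with 8 * i + (32 + a) |-> x].
Proof.
move=> a8 [Mv Ma]; split=> [w w16|b j b8] /=.
  by rewrite ifF ?Mv //; lia.
rewrite Ma //; congr (if _ then _ else _).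
by apply/eqP/andP; [move=> ?; split; lia | case=> /eqP-> /eqP->].
Qed.

(** Variables 0 and 1 are never assigned and are the only loop bounds, so a common bound on their
    initial values bounds the number of rounds of every loop. *)
Fixpoint cmd_ok (c : cmd) : bool :=
  match c with
  | Assign v e => (1 < v < 16) && expr_ok e 16
  | Put a e1 e2 => [&& a < 8, expr_ok e1 16 & expr_ok e2 17]
  | Get v => 1 < v < 16
  | Emit e => expr_ok e 16
  | Seq c1 c2 => cmd_ok c1 && cmd_ok c2
  | If e c1 => expr_ok e 16 && cmd_ok c1
  | For v b c1 => [&& 1 < v < 16, b < 2, ~~ assigns v c1 & cmd_ok c1]
  end.

(* Jump targets are absolute: [l] is the position of the compiled code. *)
Fixpoint compile (c : cmd) (l : nat) : program :=
  match c with
  | Assign v e => compile_expr e 16 ++ [:: Const 17 0; Add v 16 17]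
  | Put a e1 e2 =>
      compile_expr e1 16 ++ address a 16 ++ compile_expr e2 17
        ++ [:: Store 16 17]
  | Get v => [:: Read v]
  | Emit e => compile_expr e 16 ++ [:: Write 16]
  | Seq c1 c2 =>
      let p1 := compile c1 l in p1 ++ compile c2 (l + size p1)
  | If e c1 =>
      let p := compile_expr e 16 in
      let p1 := compile c1 (l + size p + 3) in
      p ++ [:: Const 17 1; Monus 16 17 16;
               JumpPos 16 (l + size p + 3 + size p1)] ++ p1
  | For v b c1 =>
      let p1 := compile c1 (l + 5) in
      [:: Const v 0; Monus 16 b v; Const 17 1; Monus 16 17 16;
          JumpPos 16 (l + 5 + size p1 + 3)]
        ++ p1 ++ [:: Const 16 1; Add v v 16; JumpPos 16 l.+1]
  end.

(** The indeterminate stands for a bound on variables 0 and 1. In a loop, 7 counts the four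
    instructions of the test and the three that increment and jump back; 5 counts the initialisation
    and the last test, which leaves the loop. *)
Fixpoint time (c : cmd) : {poly nat} :=
  match c with
  | Seq c1 c2 => (time c1 + time c2)%R
  | If e c1 => (time c1 + (size (compile_expr e 16) + 3)%N%:P)%R
  | For _ _ c1 => ((time c1 + 7%N%:P) * 'X + 5%N%:P)%R
  | _ => (size (compile c 0))%:P%R
  end.

Lemma time_Seq c1 c2 m :
  (time (Seq c1 c2)).[m]%R = (time c1).[m]%R + (time c2).[m]%R.
Proof. exact: hornerD. Qed.

Lemma time_If e c m :
  (time (If e c)).[m]%R =
    size (compile_expr e 16) + (3 + (time c).[m]%R).
Proof. by rewrite hornerD hornerC [LHS]addnC addnA. Qed.

Lemma time_For v b c m :
  (time (For v b c)).[m]%R = ((time c).[m]%R + 7) * m + 5.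
Proof. by rewrite hornerD hornerMX hornerD !hornerC. Qed.

Lemma assigns_bound b c : b < 2 -> cmd_ok c -> ~~ assigns b c.
Proof.
move=> b2; elim: c => //=.
- by move=> v e /andP[v_ok _]; lia.
- by move=> v v_ok; lia.
- by move=> c1 IH1 c2 IH2 /andP[ok1 ok2]; rewrite negb_or IH1 ?IH2.
- by move=> e c1 IH1 /andP[_ /IH1].
- move=> v w c1 IH1 /and4P[v_ok _ _ ok1]; rewrite negb_or IH1 // andbT.
  by lia.
Qed.

Lemma compileP P c s m l M :
    cmd_ok c -> code_at P l (compile c l) ->
    (forall b, b < 2 -> vars s b <= m) ->
    represents s M ->
  exists2 M', reach P (time c).[m]%R (Config l M (inbuf s) (outbuf s))
                (Config (l + size (compile c l)) M'
                   (inbuf (sem c s)) (outbuf (sem c s)))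
            & represents (sem c s) M'.
Proof.
elim: c s l M => [v e|a e1 e2|v|e|c1 IH1 c2 IH2|e c1 IH1|v b c1 IH1] s l M.
- move=> /= /andP[v_ok e_ok] /code_at_cat[P1 /= [P2 [P3 _]]] _ sM.
  have [M1 [red1 sM1 M1d _]] := compile_exprP e_ok P1 (inbuf s) (outbuf s) sM.
  eexists.
    rewrite hornerC size_cat; apply: (reach_trans red1).
    by run P2; run P3; rewrite addn2 !addnS; apply: reach_refl.
  rewrite /= M1d addn0; apply: represents_var; first lia.
  exact: represents_temp.
- move=> /and3P[a8 ok1 ok2] Pl _ sM.
  have [P1 /code_at_cat[P2 /code_at_cat[P3 [P4 _]]]] :=
    (code_at_cat _ _ _ _).1 Pl.
  have [M1 [red1 sM1 M1d M1u]] :=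
    compile_address (isT : 15 < 16 < 31) P2 (compile_exprP ok1 P1)
      (inbuf s) (outbuf s) sM.
  have [M2 [red2 sM2 M2d M2u]] := compile_exprP ok2 P3 (inbuf s) (outbuf s) sM1.
  set t1 := size (compile_expr e1 16) in red1 red2 P4.
  set t2 := size (compile_expr e2 17) in red2 P4.
  have size_c : size (compile (Put a e1 e2) l) = t1 + 5 + (t2 + 1).
    by rewrite /= size_cat /= size_cat /= -/t1 -/t2; lia.
  eexists.
    rewrite (_ : (time _).[m]%R = t1 + 5 + (t2 + 1)) ?hornerC // size_c.
    apply: (reach_trans red1); apply: (reach_trans red2).
    by run P4; rewrite !addnA addn1; apply: reach_refl.
  by rewrite /= M2d M2u // M1d; apply: represents_elt.
- move=> /= v_ok [P1 _] _ sM; eexists.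
    by rewrite hornerC; run P1; rewrite addn1; apply: reach_refl.
  by apply: represents_var; first lia.
- move=> /= e_ok /code_at_cat[P1 /= [P2 _]] _ sM.
  have [M1 [red1 sM1 M1d _]] := compile_exprP e_ok P1 (inbuf s) (outbuf s) sM.
  exists M1 => //.
  rewrite hornerC size_cat; apply: (reach_trans red1).
  by run P2; rewrite M1d addn1 addnS; apply: reach_refl.
- move=> /= /andP[ok1 ok2] /code_at_cat[P1 P2] le_m sM.
  have [M1 red1 sM1] := IH1 _ _ _ ok1 P1 le_m sM.
  have le_m1 b: b < 2 -> vars (sem c1 s) b <= m.
    by move=> b2; rewrite vars_sem ?assigns_bound ?le_m.
  have [M2 red2 sM2] := IH2 _ _ _ ok2 P2 le_m1 sM1.
  exists M2 => //; rewrite -[(_ + _)%R]/(time (Seq c1 c2)) time_Seq.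
  by rewrite size_cat addnA; apply: reach_trans red1 red2.
- move=> /= /andP[e_ok ok1] /code_at_cat[P1 /= [P2 [P3 [P4 P5]]]] le_m sM.
  have [M1 [red1 sM1 M1d _]] := compile_exprP e_ok P1 (inbuf s) (outbuf s) sM.
  (* Jumps are taken on positive values, so the body is skipped by testing [1 - eval s e]. *)
  have sM2: represents s
      [eta [eta M1 with 17 |-> 1] with 16 |-> 1 - eval s e].
    by do 2!(apply: represents_temp => //).
  rewrite -addn3 in P5.
  rewrite -[(_ + _)%R]/(time (If e c1)) time_If size_cat /=.
  set t := size (compile_expr e 16) in P1 P2 P3 P4 P5 red1 *.
  set t1 := size (compile c1 _) in P4 *.
  rewrite (_ : l + (t + t1.+3) = l + t + 3 + t1); last by lia.
  case: ifP => e_pos; last first.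
    eexists; last exact: sM2.
    apply: (reach_trans red1); run P2; run P3; run P4.
    by rewrite M1d (_ : 1 - eval s e = 1) /=; [apply: reach_refl | lia].
  have [M3 red3 sM3] := IH1 _ _ _ ok1 P5 le_m sM2.
  exists M3 => //; apply: (reach_trans red1); run P2; run P3; run P4.
  rewrite M1d (_ : 0 < 1 - eval s e = false) -1?[(l + t).+3]addn3; last by lia.
  exact: red3.
move=> ok Pl le_m sM; rewrite time_For.
have /= /and4P[v_ok b2 v_c1 ok1] := ok.
have /= [P0 [P1 [P2 [P3 [P4]]]]] := Pl.
move=> /code_at_cat[P5 /= [P6 [P7 [P8 _]]]].
set p1 := compile c1 _ in P4 P5 P6 P7 P8; set L := l + 5 + size p1 + 3.
have {Pl} -> : l + size (compile (For v b c1) l) = L.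
  by rewrite /= size_cat /= -/p1 /L; lia.
have e5 : l.+1.+4 = l + 5 by lia.
rewrite {}e5 in P5 P6 P7 P8.
pose f s1 := set_var v (vars s1 v).+1 (sem c1 s1).
rewrite /= -/f; pose s0 := set_var v 0 s; pose N := vars s b; rewrite -/s0 -/N.
have [v16 b16]: v < 16 /\ b < 16 by lia.
have inv j: let sj := iter j f s0 in
    vars sj v = j /\ forall b', b' < 2 -> vars sj b' = vars s b'.
  elim: j => [|j [IHv IHb]] /=.
    by split=> [|b' b'2]; rewrite ?eqxx // ifF //; lia.
  rewrite eqxx IHv; split=> // b' b'2; rewrite ifF; last by lia.
  by rewrite vars_sem ?assigns_bound // IHb.
(* Induction on the number [d] of rounds still to run, from the loop test at [l.+1]; the 4 pays for
   the exit test. *)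
have loop d j M1 : j + d = N -> represents (iter j f s0) M1 ->
    exists2 M', reach P (((time c1).[m]%R + 7) * d + 4)
      (Config l.+1 M1 (inbuf (iter j f s0)) (outbuf (iter j f s0)))
      (Config L M' (inbuf (iter N f s0)) (outbuf (iter N f s0)))
    & represents (iter N f s0) M'.
  elim: d j M1 => [|d IHd] j M1 jd sM1; have [vj bj] := inv j.
    rewrite addn0 in jd; rewrite -jd; eexists.
      rewrite muln0; run P1; run P2; run P3; run P4.
      rewrite !(proj1 sM1) // vj bj // -/N jd subnn /=; exact: reach_refl.
    by do 3!(apply: represents_temp => //).
  have sM2 : represents (iter j f s0)
      [eta [eta [eta M1 with 16 |-> N - j] with 17 |-> 1]
        with 16 |-> 1 - (N - j)].
    by do 3!(apply: represents_temp => //).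
  have le_mj b' : b' < 2 -> vars (iter j f s0) b' <= m.
    by move=> b'2; rewrite bj ?le_m.
  have [M3 red3 sM3] := IH1 _ _ _ ok1 P5 le_mj sM2.
  have vj3 : M3 v = j by rewrite (proj1 sM3) ?vars_sem.
  have sM4 : represents (iter j.+1 f s0)
      [eta [eta M3 with 16 |-> 1] with v |-> j.+1].
    by rewrite /= {1}/f vj; apply: represents_var => //; apply: represents_temp.
  have [|M' red' sM'] := IHd j.+1 _ _ sM4; first by rewrite addSnnS.
  exists M' => //; set t1 := (time c1).[m]%R in red3 red' *.
  rewrite (_ : (t1 + 7) * d.+1 + 4 = 4 + (t1 + (3 + ((t1 + 7) * d + 4))));
    last by rewrite mulnS; lia.
  apply: (reach_trans (t1 := 4)).
    run P1; run P2; run P3; run P4.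
    rewrite !(proj1 sM1) // vj bj // -/N.
    rewrite (_ : 0 < 1 - (N - j) = false); last by lia.
    rewrite (_ : l.+1.+4 = l + 5); last by lia.
    exact: reach_refl.
  apply: (reach_trans red3); apply: (reach_trans (t1 := 3)).
    run P6; run P7; run P8.
    have [-> ->] : (16 == v) = false /\ (v == 16) = false by lia.
    rewrite vj3 addn1; exact: reach_refl.
  exact: red'.
have [M' red' sM'] := loop N 0 _ (add0n _) (represents_var 0 v16 sM).
exists M' => //; apply: reach_le (_ : ((time c1).[m]%R + 7) * N + 5 <= _) _.
  by rewrite leq_add2r leq_mul2l le_m ?orbT.
by rewrite addnS; run P0; apply: red'.
Qed.

Lemma iter_step_halted P c t : halted P c -> iter t (step P) c = c.
Proof.
move=> c_halted; elim: t => //= t ->.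
by rewrite /step onth_default.
Qed.

(** The state behind the header of [guarded]: two words are read, and the 1 that announces a
    solution is already written. *)
Definition start (n k : nat) (w : seq nat) : state :=
  State (nth 0 [:: n; k]) (fun _ _ => 0) w [:: 1].

(* An input starting with 0 gets the answer [:: 1] at once: on such an input the
   second word may be exponential in the size of the input. *)
Definition guarded (c : cmd) : program :=
  [:: Const 16 1; Read 0; Read 1; Write 16; Monus 16 16 0;
      JumpPos 16 (6 + size (compile c 6))] ++ compile c 6.

(** The header has 6 instructions. The bound on [k] is asked for only when [0 < n], the case in
    which the body runs. *)
Lemma guardedP c n k w m :
    cmd_ok c -> n <= m -> (0 < n -> k <= m) ->
  halts_within (guarded c) [:: n, k & w] ((time c).[m]%R + 6)
    (if n == 0 then [:: 1] else outbuf (sem c (start n k w))).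
Proof.
move=> c_ok nm km; set out := if _ then _ else _; set P := guarded c.
suff [M red] : exists M, exists inp, reach P ((time c).[m]%R + 6)
    (initial [:: n, k & w]) (Config (size P) M inp out).
  case: red => inp [t le_t red].
  rewrite /halts_within -(subnK le_t) iterD red.
  by rewrite iter_step_halted ?/halted /=.
have /= [P0 [P1 [P2 [P3 [P4 [P5 P6]]]]]] := code_at_self P.
rewrite /initial addnC.
have run_header M' inp (out' : seq nat) :
  reach P (time c).[m]%R
    (Config (if 0 < 1 - n then size P else 6)
       [eta [eta [eta [eta fun=> 0 with 16 |-> 1] with 0 |-> n] with 1 |-> k]
         with 16 |-> 1 - n] w [:: 1]) (Config (size P) M' inp out') ->
  reach P (6 + (time c).[m]%R)
    (Config 0 (fun=> 0) [:: n, k & w] [::]) (Config (size P) M' inp out').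
  by move=> red; run P0; run P1; run P2; run P3; run P4; run P5.
case: n => [|n] in nm km out run_header *.
  by do 2!eexists; apply: run_header; apply: reach_refl.
have sM : represents (start n.+1 k w)
    [eta [eta [eta [eta fun=> 0 with 16 |-> 1] with 0 |-> n.+1] with 1 |-> k]
      with 16 |-> 1 - n.+1].
  split=> [v v16|a i a8] /=; last by rewrite !ifF //; lia.
  by case: v v16 => [|[|v]] v16 //; rewrite [RHS]nth_nil !ifF //; lia.
have le_m b : b < 2 -> vars (start n.+1 k w) b <= m.
  by case: b => [|[_|]] //; apply: km.
have [M red _] := compileP c_ok P6 le_m sM.
by exists M, (inbuf (sem c (start n.+1 k w))); apply: run_header; apply: red.
Qed.

(** * Forests *)

Section Forests.

Variable T : finType.
Implicit Types (F E : {set {set T}}) (u v x y : T).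

Lemma adj_sym F : symmetric (adj F).
Proof. by move=> u v; rewrite /adj setUC. Qed.

Lemma connect_adj_sym F : connect_sym (adj F).
Proof. exact/sym_connect_sym/adj_sym. Qed.

Lemma adjS F F' : F \subset F' -> subrel (adj F) (adj F').
Proof. by move=> /subsetP sFF' u v; apply: sFF'. Qed.

Lemma connect_adjS F F' u v :
  F \subset F' -> connect (adj F) u v -> connect (adj F') u v.
Proof.
move=> sFF'; apply: (connect_sub (e' := adj F')) => x y xy.
exact/connect1/(adjS sFF').
Qed.

Lemma eq_set2 u v x y :
  ([set x; y] == [set u; v]) = (x == u) && (y == v) || (x == v) && (y == u).
Proof.
apply/eqP/idP => [/setP eq_xy|/orP[]/andP[/eqP-> /eqP->]]; rewrite // 1?setUC //.
have := eq_xy x; have := eq_xy y; have := eq_xy u; have := eq_xy v.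
rewrite !inE !eqxx !orbT /= (eq_sym u x) (eq_sym u y) (eq_sym v x) (eq_sym v y).
by case: (x == u); case: (x == v); case: (y == u); case: (y == v).
Qed.

Lemma adjU1 F u v x y :
  adj ([set u; v] |: F) x y ->
  adj F x y \/ (x = u /\ y = v) \/ (x = v /\ y = u).
Proof.
rewrite /adj in_setU1 eq_set2 => /orP[/orP[]/andP[/eqP-> /eqP->]|]; auto.
Qed.

(** Every step of the path starts in [x :: p], whereas a step along the new edge starts in [u] or
    [v]. The endpoint [y] stays free, as it is an end of the new edge in the application. *)
Lemma path_adjU1 F u v x p y :
    path (adj ([set u; v] |: F)) x (rcons p y) ->
    (u \notin x :: p) -> (v \notin x :: p) ->
  path (adj F) x (rcons p y).
Proof.
elim: p x => [|z p IHp] x; rewrite !(in_cons x).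
  rewrite /= !andbT => /adjU1 xy /norP[ux _] /norP[vx _].
  by case: xy ux vx => [//|[[-> _]|[-> _]]]; rewrite eqxx.
move=> /andP[xz zy] /norP[ux uzp] /norP[vx vzp].
rewrite /= (IHp _ zy uzp vzp) andbT.
by case: (adjU1 xz) ux vx => [//|[[-> _]|[-> _]]]; rewrite eqxx.
Qed.

(* A cycle through the new edge can be rotated to start with it; the rest of
   the cycle then connects its endpoints in F. *)
Lemma acyclicU1 F u v :
  acyclic F -> ~~ connect (adj F) u v -> acyclic ([set u; v] |: F).
Proof.
move=> acF nuv c c_gt2 /andP[cyc c_uniq].
(* A cycle all of whose steps lie in [F] contradicts [acF]; otherwise some step is the new edge. *)
have [/allP inF | /allPn[x xc nF]] :=
    boolP (all (fun x => adj F x (next c x)) c).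
  by apply: (acF c c_gt2); rewrite /ucycle c_uniq cycle_from_next.
have := next_cycle cyc xc => /adjU1; rewrite (negPf nF) => -[//|xuv].
have [i c' rot_c] := rot_to xc.
have eq_next : next c x = next (x :: c') x by rewrite -rot_c next_rot.
have := cyc; rewrite -(rot_cycle i) rot_c.
have := c_uniq; rewrite -(rot_uniq i) rot_c.
have := c_gt2; rewrite -(size_rot i) rot_c.
case: c' {rot_c} eq_next => [|y [|z p]] // eq_next _.
rewrite /= eqxx in eq_next; rewrite {}eq_next in xuv.
move=> /andP[xyzp /andP[yzp _]] /andP[_ /andP[yz zpx]].
have [x_yzp y_zp] : x \notin z :: p /\ y \notin z :: p.
  by move: xyzp; rewrite (in_cons y) => /norP[].
have uv_xy: [set u; v] = [set x; y] by case: xuv => -[-> ->]; rewrite // setUC.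
rewrite {}uv_xy in yz zpx; case/negP: nuv.
have conxy: connect (adj F) y x.
  apply/connectP; exists (rcons (z :: p) x); last by rewrite last_rcons.
  rewrite rcons_cons /= (path_adjU1 zpx) // andbT.
  case/adjU1: yz => [//|[[_ zy]|[_ zx]]].
    by rewrite zy mem_head in y_zp.
  by rewrite zx mem_head in x_yzp.
by case: xuv conxy => -[-> ->] //; rewrite connect_adj_sym.
Qed.

(* An edge outside F whose endpoints are connected in F closes a cycle. *)
Lemma acyclic_maximal F F' (E : {set {set T}}) :
    (forall e, e \in E -> #|e| = 2) ->
    (forall u v, adj E u v -> connect (adj F) u v) ->
    F' \subset E -> acyclic F' -> F \subset F' ->
  F' = F.
Proof.
move=> E2 conF /subsetP sF'E acF' sFF'; apply/eqP; rewrite eqEsubset sFF' andbT.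
apply/subsetP => e eF'; apply: contraT => eF.
have /eqP/cards2P[u [v [uv def_e]]] := E2 e (sF'E e eF').
have /connectP[p0] : connect (adj F) u v by apply: conF; rewrite /adj -def_e sF'E.
case/shortenP => p uPp p_uniq _ def_v.
(* The empty path contradicts [u != v], a single step would put [e] into [F], and a longer path is
   closed by [e] to a cycle of [F']. *)
case: p => [|x [|y p]] in uPp p_uniq def_v *.
- by rewrite def_v eqxx in uv.
- by move: uPp eF; rewrite /= andbT def_e def_v /= /adj => ->.
case: (acF' (u :: [:: x, y & p])) => //; rewrite /ucycle p_uniq andbT.
rewrite -[cycle _ _]/(path _ _ (rcons [:: x, y & p] u)) rcons_path.
rewrite (sub_path (adjS sFF') uPp) -def_v.
by rewrite adj_sym /adj -def_e.
Qed.

(** Merging two components by overwriting the label of [v] with that of [u]. From right to left it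
    suffices that [f'] is constant along each edge of a path. *)
Lemma connect_adjU1 F u v (f : T -> nat) :
    (forall x y, (f x == f y) = connect (adj F) x y) ->
  let f' x := if f x == f v then f u else f x in
  forall x y, (f' x == f' y) = connect (adj ([set u; v] |: F)) x y.
Proof.
move=> conF f' x y; have sFF' : F \subset [set u; v] |: F by apply: subsetUr.
have conF' a b : f a == f b -> connect (adj ([set u; v] |: F)) a b.
  by rewrite conF; apply: connect_adjS.
have uv : connect (adj ([set u; v] |: F)) u v.
  by rewrite connect1 // /adj setU11.
have vu : connect (adj ([set u; v] |: F)) v u by rewrite connect_adj_sym.
apply/idP/connectP => [|[p]].
  move=> xy; apply/connectP; move: xy; rewrite /f'.
  case: ifP => [xv|_]; case: ifP => [yv|_] xy.
  - by apply: (connect_trans (conF' _ _ xv)); rewrite connect_adj_sym conF'.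
  - exact: connect_trans (conF' _ _ xv) (connect_trans vu (conF' _ _ xy)).
  - apply: connect_trans (conF' _ _ xy) (connect_trans uv _).
    by rewrite connect_adj_sym conF'.
  - exact: conF'.
elim: p x => [|z p IHp] x /=; first by move=> _ ->.
move=> /andP[xz zp] y_last; have {IHp} := IHp z zp y_last; rewrite /f' => /eqP <-.
case: (adjU1 xz) => [/connect1|[[-> ->]|[-> ->]]].
- by rewrite -conF => /eqP->.
- by rewrite eqxx; case: ifP => _; rewrite eqxx.
- by rewrite eqxx; case: ifP => _; rewrite eqxx.
Qed.

Lemma acyclic0 : acyclic (set0 : {set {set T}}).
Proof. by move=> [|x [|y c]] //= _ /andP[/andP[]]; rewrite /adj in_set0. Qed.

End Forests.

(** * Kruskal's algorithm *)

Local Notation var_n := 0.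
Local Notation var_k := 1.
Local Notation var_u := 2.
Local Notation var_v := 3.
Local Notation var_w := 4.
Local Notation var_i := 5.
Local Notation var_key := 6.
Local Notation var_a := 7.
Local Notation var_b := 8.

Local Notation rows := 0.
Local Notation owners := 1.
Local Notation marks := 2.
Local Notation labels := 3.
Local Notation saved := 4.

(** With truncated subtraction this is the absolute difference. *)
Definition differ (e1 e2 : expr) : expr := Plus (Minus e1 e2) (Minus e2 e1).

Definition same (e1 e2 : expr) : expr := Minus (Cst 1) (differ e1 e2).

(** The row-major index of a vertex pair: [rows] is a table of the multiples of [n], filled by
    repeated addition. *)
Definition cell (u v : nat) : expr := Plus (Elt rows (Var u)) (Var v).

Definition for_cells (c : cmd) : cmd := For var_u var_n (For var_v var_n c).

Definition fill_rows : cmd :=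
  For var_u var_n
    (Seq (Put rows (Var var_u) (Var var_a))
         (Assign var_a (Plus (Var var_a) (Var var_n)))).

(* The owner of an edge is i + 1 if it belongs to the i-th graph only, k + 1 if
   it belongs to several graphs; the owner of a non-edge is 0. *)
Definition read_cell : cmd :=
  Seq (Get var_b)
    (If (Var var_b)
      (Seq (Assign var_key (Plus (Var var_i) (Cst 1)))
        (Seq (If (Elt owners (cell var_u var_v))
                (Assign var_key (Plus (Var var_k) (Cst 1))))
             (Put owners (cell var_u var_v) (Var var_key))))).

(** The loop over [var_w] consumes the vertex row that precedes each edge matrix. *)
Definition read_graphs : cmd :=
  For var_i var_k (Seq (For var_w var_n (Get var_b)) (for_cells read_cell)).

Definition relabel : cmd :=
  For var_w var_n
    (If (same (Elt labels (Var var_w)) (Var var_b))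
        (Put labels (Var var_w) (Var var_a))).

(** Both labels are put into variables because [relabel] overwrites the array they come from; both
    orientations are marked to keep the output matrix symmetric. *)
Definition link_cell : cmd :=
  Seq (Put marks (cell var_u var_v) (Cst 1))
    (Seq (Put marks (cell var_v var_u) (Cst 1))
      (Seq (Assign var_a (Elt labels (Var var_u)))
           (Assign var_b (Elt labels (Var var_v))))).

Definition try_cell : cmd :=
  If (same (Elt owners (cell var_u var_v)) (Var var_key))
    (If (differ (Elt labels (Var var_u)) (Elt labels (Var var_v)))
      (Seq link_cell relabel)).

Definition copy (a b : nat) : cmd :=
  For var_w var_n (Put b (Var var_w) (Elt a (Var var_w))).

Definition grow (e : expr) : cmd := Seq (Assign var_key e) (for_cells try_cell).

Definition emit_marks : cmd := for_cells (Emit (Elt marks (cell var_u var_v))).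

(** The labels reached after the shared edges are saved and restored for every graph: they must
    describe components within that graph, not within the union of all forests. *)
Definition solve : cmd :=
  Seq fill_rows
    (Seq read_graphs
      (Seq (For var_w var_n (Put labels (Var var_w) (Var var_w)))
        (Seq (grow (Plus (Var var_k) (Cst 1)))
          (Seq (copy labels saved)
            (Seq (For var_i var_k
                   (Seq (copy saved labels)
                     (grow (Plus (Var var_i) (Cst 1)))))
                 emit_marks))))).

(** * Semantics of the loops *)

Lemma solve_ok : cmd_ok solve.
Proof. by []. Qed.

Lemma eval_differ s e1 e2 :
  (0 < eval s (differ e1 e2)) = (eval s e1 != eval s e2).
Proof. by rewrite /=; lia. Qed.

Lemma eval_same s e1 e2 : (0 < eval s (same e1 e2)) = (eval s e1 == eval s e2).
Proof. by rewrite /=; lia. Qed.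

Lemma sem_If e c s : sem (If e c) s = if 0 < eval s e then sem c s else s.
Proof. by []. Qed.

Definition ready (n k : nat) (s : state) : Prop :=
  [/\ vars s var_n = n, vars s var_k = k &
      forall u, u < n -> arrs s rows u = u * n].

Lemma ready_sem n k c s :
    ~~ [|| assigns var_n c, assigns var_k c | puts rows c] ->
  ready n k s -> ready n k (sem c s).
Proof.
rewrite !negb_or => /and3P[cn ck cr] [sn sk sr].
by split; rewrite ?vars_sem ?arrs_sem.
Qed.

(** The nested loops behave as one loop over the row-major index. The first two hypotheses make [J]
    insensitive to the counters, since updating them must not disturb it. *)
Lemma for_cells_ind (J : nat -> state -> Prop) n k c s :
    (forall t s1 x, J t s1 -> J t (set_var var_u x s1)) ->
    (forall t s1 x, J t s1 -> J t (set_var var_v x s1)) ->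
    ~~ [|| assigns var_u c, assigns var_v c, assigns var_n c, assigns var_k c
         | puts rows c] ->
    (forall u v s1, u < n -> v < n -> vars s1 var_u = u -> vars s1 var_v = v ->
       ready n k s1 -> J (u * n + v) s1 -> J (u * n + v).+1 (sem c s1)) ->
    ready n k s -> J 0 s ->
  J (n * n) (sem (for_cells c) s).
Proof.
rewrite !negb_or => Ju Jv /and5P[cu cv cn ck cr] Jc s_ready J0.
have [sn _ _] := s_ready.
suff: J (n * n) (sem (for_cells c) s) /\ ready n k (sem (for_cells c) s) by case.
rewrite -{1}sn.
apply: (sem_For_ind (I := fun u s1 => J (u * n) s1 /\ ready n k s1)) => //.
  by split; [apply: Ju | case: s_ready].
rewrite sn => u s1 lt_un s1u [Js1 s1_ready]; have [s1n _ _] := s1_ready.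
suff [J2 s2_ready]:
  J (u.+1 * n) (sem (For var_v var_n c) s1)
  /\ ready n k (sem (For var_v var_n c) s1).
  by split; [apply: Ju | case: s2_ready].
split; last by apply: ready_sem; rewrite //= !negb_or cn ck cr.
rewrite mulSnr -{2}s1n.
suff: J (u * n + vars s1 var_n) (sem (For var_v var_n c) s1)
    /\ ready n k (sem (For var_v var_n c) s1)
    /\ vars (sem (For var_v var_n c) s1) var_u = u by case.
apply: (sem_For_ind (I := fun v s2 => J (u * n + v) s2 /\ ready n k s2
                                      /\ vars s2 var_u = u)) => //.
  by rewrite addn0; split; [apply: Jv | case: s1_ready].
rewrite s1n => v s2 lt_vn s2v [Js2 [s2_ready s2u]]; split.
  by apply: Jv; rewrite addnS; apply: Jc.
split; last by rewrite /= vars_sem.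
have [] // : ready n k (sem c s2).
by apply: ready_sem; rewrite // !negb_or cn ck cr.
Qed.

Lemma index_inj n u v u' v' : v < n -> v' < n ->
  (u * n + v == u' * n + v') = (u == u') && (v == v').
Proof.
move=> lt_vn lt_v'n; apply/eqP/andP => [|[/eqP-> /eqP->] //].
move=> eq_uv; have := congr1 (divn^~ n) eq_uv; have := congr1 (modn^~ n) eq_uv.
have n_gt0 : 0 < n by apply: leq_ltn_trans lt_vn.
by rewrite !modnMDl !divnMDl // !modn_small // !divn_small // !addn0 => -> ->.
Qed.

Lemma fill_rowsP n k w : ready n k (sem fill_rows (start n k w)).
Proof.
suff [] : [/\ vars (sem fill_rows (start n k w)) var_n = n,
    vars (sem fill_rows (start n k w)) var_a = n * n &
    forall u, u < n -> arrs (sem fill_rows (start n k w)) rows u = u * n].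
  by split; rewrite // vars_sem.
apply: (sem_For_ind (I := fun j s => [/\ vars s var_n = n, vars s var_a = j * n
  & forall u, u < j -> arrs s rows u = u * n]) (s := start n k w)) => //.
move=> j s _ /= sj [sn sa sr]; split=> [||u] //=; first by rewrite sa sn mulSnr.
by rewrite ltnS leq_eqVlt sj; case: (eqVneq u j) => [->|_ /sr].
Qed.

Lemma relabelP n k s w :
  ready n k s -> w < n ->
  arrs (sem relabel s) labels w =
    if arrs s labels w == vars s var_b then vars s var_a else arrs s labels w.
Proof.
move=> [sn _ _] lt_wn; pose new w' :=
  if arrs s labels w' == vars s var_b then vars s var_a else arrs s labels w'.
suff [_ ->] : (vars (sem relabel s) var_a = vars s var_a /\
    vars (sem relabel s) var_b = vars s var_b) /\
    forall w', arrs (sem relabel s) labels w' =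
      if w' < vars s var_n then new w' else arrs s labels w'.
  by rewrite /new sn lt_wn.
apply: (sem_For_ind (I := fun j s1 => (vars s1 var_a = vars s var_a /\
  vars s1 var_b = vars s var_b) /\ forall w', arrs s1 labels w' =
    if w' < j then new w' else arrs s labels w')) => // j s1 _ s1w [[s1a s1b] s1l].
(* Round [j] reads entry [j], which still has its original label. *)
have -> : sem (If (same (Elt labels (Var var_w)) (Var var_b))
    (Put labels (Var var_w) (Var var_a))) s1 =
  if arrs s labels j == vars s var_b then set_elt labels j (vars s var_a) s1
  else s1.
  rewrite sem_If eval_same.
  by rewrite /= s1w s1l ltnn s1b s1a.
split=> [|w']; first by case: ifP.
have -> : arrs (set_var var_w j.+1 (if arrs s labels j == vars s var_b
    then set_elt labels j (vars s var_a) s1 else s1)) labels w' =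
  if w' == j then new j else arrs s1 labels w'.
  rewrite /new; case: ifP => _ //=.
  by case: eqP => [->|//]; rewrite s1l ltnn.
by rewrite s1l ltnS [w' <= j]leq_eqVlt; case: (eqVneq w' j) => [->|_].
Qed.

(** Serves both the initial labels and [copy]: [e] may read any array but the one being filled. *)
Lemma fillP n k a e f s w :
    (forall s1, (forall b, b != a -> arrs s1 b = arrs s b) ->
       eval s1 e = f (vars s1 var_w)) ->
    ready n k s -> w < n ->
  arrs (sem (For var_w var_n (Put a (Var var_w) e)) s) a w = f w.
Proof.
move=> e_f [sn _ _]; rewrite -sn; move: w.
suff [] : (forall b, b != a ->
      arrs (sem (For var_w var_n (Put a (Var var_w) e)) s) b = arrs s b)
    /\ forall w, w < vars s var_n ->
      arrs (sem (For var_w var_n (Put a (Var var_w) e)) s) a w = f w by [].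
apply: (sem_For_ind (I := fun j s1 => (forall b, b != a -> arrs s1 b = arrs s b)
  /\ forall w, w < j -> arrs s1 a w = f w)) => // j s1 _ s1w [s1b s1a].
split=> [b ba|w] /=; first by rewrite (negPf ba) s1b.
rewrite eqxx ltnS leq_eqVlt s1w (e_f _ s1b) s1w /=.
by case: eqVneq => [->|_ /s1a].
Qed.

Lemma copyP n k a b s w :
  a != b -> ready n k s -> w < n -> arrs (sem (copy a b) s) b w = arrs s a w.
Proof.
move=> ab; apply: (fillP (f := arrs s a)) => s1 s1_arrs.
by rewrite /= s1_arrs.
Qed.

(** The entry of [owners] for a vertex pair once [m] graphs are read, where [b j] tells whether the
    pair is an edge of the graph numbered [j]. *)
Fixpoint owner (k : nat) (b : nat -> bool) (m : nat) : nat :=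
  if m is m'.+1 then
    if b m' then if 0 < owner k b m' then k.+1 else m else owner k b m'
  else 0.

Lemma ownerP k (b : nat -> bool) m :
  [\/ owner k b m = 0 /\ (forall j, j < m -> ~~ b j),
      exists i, [/\ i < m, owner k b m = i.+1 &
                    forall j, j < m -> b j = (j == i)]
    | owner k b m = k.+1 /\ exists i j, [/\ i < j, j < m, b i & b j]].
Proof.
elim: m => [|m IHm] /=; first by constructor 1.
have [bm|nbm] := boolP (b m); last first.
  case: IHm => [[-> nb]|[i [im -> bi]]|[-> [i [j [ij jm bi bj]]]]].
  - constructor 1; split=> // j; rewrite ltnS leq_eqVlt => /predU1P[->//|].
    exact: nb.
  - constructor 2; exists i; split=> // [|j]; first exact: ltnW.
    rewrite [j < _]ltnS [j <= m]leq_eqVlt => /predU1P[->|/bi//].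
    by rewrite (negPf nbm) gtn_eqF.
  - by constructor 3; split=> //; exists i, j; split=> //; apply: ltnW.
case: IHm => [[-> nb]|[i [im -> bi]]|[-> [i [j [ij jm bi bj]]]]] /=.
- constructor 2; exists m; split=> // j.
  rewrite [j < _]ltnS [j <= m]leq_eqVlt => /predU1P[->|jm].
    by rewrite eqxx.
  by rewrite (negPf (nb j jm)) ltn_eqF.
- by constructor 3; split=> //; exists i, m; split=> //; rewrite bi ?eqxx.
- by constructor 3; split=> //; exists i, j; split=> //; apply: ltnW.
Qed.

(** The bound [m <= k] keeps the number [i.+1] of a single graph apart from the value [k.+1] for
    shared edges. *)
Lemma owner_shared k (b : nat -> bool) m : m <= k ->
  reflect (exists i j, [/\ i < j, j < m, b i & b j]) (owner k b m == k.+1).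
Proof.
move=> mk; apply: (iffP eqP) => [o_eq|[i [j [ij jm bi bj]]]].
  case: (ownerP k b m) => [[]|[i [im]]|[]] //; first by rewrite o_eq.
  by rewrite o_eq => -[ki]; rewrite -ki ltnNge mk in im.
case: (ownerP k b m) => [[_ nb]|[l [lm _ bl]]|[]] //.
  by rewrite (negPf (nb j jm)) in bj.
move: bi bj; rewrite !bl // ?(ltn_trans ij) // => /eqP il /eqP jl.
by rewrite il jl ltnn in ij.
Qed.

Lemma owner_exclusive k (b : nat -> bool) i : i < k ->
  (owner k b k == i.+1) = b i && (owner k b k != k.+1).
Proof.
move=> ik; apply/eqP/andP => [o_eq|[bi]].
  case: (ownerP k b k) => [[]|[l [lk]]|[]]; rewrite o_eq //.
    by move=> [<-] ->; rewrite // eqxx eqSS ltn_eqF.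
  by move=> [ki]; rewrite ki ltnn in ik.
case: (ownerP k b k) => [[_ nb]|[l [lk -> bl]]|[-> _]]; rewrite ?eqxx //.
  by rewrite (negPf (nb i ik)) in bi.
by rewrite bl // in bi; rewrite (eqP bi).
Qed.

Lemma skipP s :
  inbuf (sem (For var_w var_n (Get var_b)) s) = drop (vars s var_n) (inbuf s).
Proof.
apply: (sem_For_ind (I := fun j s1 => inbuf s1 = drop j (inbuf s))) => //.
  by rewrite drop0.
by move=> j s1 _ _ /= ->; rewrite -drop1 drop_drop.
Qed.

Lemma read_cellP n k s (t := vars s var_u * n + vars s var_v)
    (x := head 0 (inbuf s)) :
    ready n k s -> vars s var_u < n ->
  inbuf (sem read_cell s) = behead (inbuf s) /\
  forall t', arrs (sem read_cell s) owners t' =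
    if (t' == t) && (0 < x)
    then if 0 < arrs s owners t then k.+1 else (vars s var_i).+1
    else arrs s owners t'.
Proof.
move=> [sn sk sr] lt_un; rewrite /read_cell /= -/x.
have [x_gt0|_] := boolP (0 < x); last by split=> // t'; rewrite andbF.
rewrite /= sr // -/t; have [o_gt0|o0] := boolP (0 < arrs s 1 t).
  by split=> //= t'; rewrite sr // -/t sk addn1 andbT.
by split=> //= t'; rewrite sr // -/t addn1 andbT.
Qed.

Lemma read_graphP n k i s (g rest : seq nat) (b : nat -> nat -> bool) :
    size g = n * n -> (forall t, t < n * n -> b t i = (0 < nth 0 g t)) ->
    ready n k s -> vars s var_i = i -> inbuf s = g ++ rest ->
    (forall t, t < n * n -> arrs s owners t = owner k (b t) i) ->
  inbuf (sem (for_cells read_cell) s) = rest /\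
  forall t, t < n * n ->
    arrs (sem (for_cells read_cell) s) owners t = owner k (b t) i.+1.
Proof.
move=> size_g bg s_ready si s_in so.
(* Entries before [t] have seen one graph more than the others; the boolean counts it. *)
pose J t s1 := [/\ vars s1 var_i = i, inbuf s1 = drop t g ++ rest &
  forall t', t' < n * n -> arrs s1 owners t' = owner k (b t') (i + (t' < t))].
suff [_ -> so']: J (n * n) (sem (for_cells read_cell) s).
  split=> [|t lt_t]; first by rewrite -size_g drop_size.
  by rewrite so' // lt_t addn1.
apply: for_cells_ind s_ready _ => //; last first.
  by split=> [||t lt_t] //; rewrite ?drop0 ?addn0 ?so.
move=> u v s1 lt_un lt_vn s1u s1v s1_ready [s1i s1_in s1o].
have lt_t : u * n + v < n * n by nia.
have [|r_in r_o] := @read_cellP n k s1 s1_ready; first by rewrite s1u.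
have drop_g : drop (u * n + v) g = nth 0 g (u * n + v) :: drop (u * n + v).+1 g.
  by apply: drop_nth; rewrite size_g.
rewrite s1u s1v s1i s1_in drop_g /= in r_in r_o; split=> [||t' lt_t'] //.
  by rewrite vars_sem.
rewrite r_o -bg // [t' < _]ltnS [t' <= _]leq_eqVlt !s1o // ltnn addn0.
case: eqP => [->|_] //=; rewrite ltnn addn0 addn1 /=.
by case: (b _ i).
Qed.

Lemma read_graphsP n k s (h g : nat -> seq nat) (b : nat -> nat -> bool) :
    (forall i, i < k -> size (h i) = n) ->
    (forall i, i < k -> size (g i) = n * n) ->
    (forall i t, i < k -> t < n * n -> b t i = (0 < nth 0 (g i) t)) ->
    ready n k s -> inbuf s = flatten [seq h i ++ g i | i <- iota 0 k] ->
    (forall t, arrs s owners t = 0) ->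
  forall t, t < n * n ->
    arrs (sem read_graphs s) owners t = owner k (b t) k.
Proof.
move=> size_h size_g bg s_ready s_in so; have [sn sk _] := s_ready.
pose I i s1 := [/\ ready n k s1,
  inbuf s1 = flatten [seq h j ++ g j | j <- iota i (k - i)] &
  forall t, t < n * n -> arrs s1 owners t = owner k (b t) i].
suff [] : I (vars s var_k) (sem read_graphs s) by rewrite sk.
apply: (sem_For_ind (I := I)) => //.
  by split; [case: s_ready | rewrite subn0 | move=> t _; apply: so].
rewrite sk => i s1 lt_ik s1i [s1_ready s1_in s1o].
set s2 := sem (For var_w var_n (Get var_b)) s1.
have s2_ready : ready n k s2 by apply: ready_sem.
have s2_in : inbuf s2 =
    g i ++ flatten [seq h j ++ g j | j <- iota i.+1 (k - i.+1)].
  have [s1n _ _] := s1_ready.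
  rewrite skipP s1n s1_in -(subnSK lt_ik) /=.
  by rewrite -catA drop_size_cat ?size_h.
have [|t lt_t|s3_in s3o] := @read_graphP n k i s2 (g i) _ b (size_g i lt_ik)
    (fun t => bg i t lt_ik) s2_ready _ s2_in.
- by rewrite vars_sem.
- by rewrite arrs_sem // s1o.
split=> //; have [] // : ready n k (sem (for_cells read_cell) s2).
exact: ready_sem.
Qed.

Lemma emit_marksP n k s :
  ready n k s ->
  outbuf (sem emit_marks s) = outbuf s ++ mkseq (arrs s marks) (n * n).
Proof.
move=> s_ready.
pose J t s1 := arrs s1 marks = arrs s marks /\
  outbuf s1 = outbuf s ++ mkseq (arrs s marks) t.
suff [] : J (n * n) (sem emit_marks s) by [].
apply: for_cells_ind s_ready _ => //; last by split; rewrite ?cats0.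
move=> u v s1 lt_un lt_vn s1u s1v s1_ready [s1m s1_out].
have -> : sem (Emit (Elt marks (cell var_u var_v))) s1 =
  State (vars s1) (arrs s1) (inbuf s1)
    (rcons (outbuf s1) (arrs s marks (u * n + v))).
  by have [_ _ s1r] := s1_ready; rewrite /= s1u s1r // s1v s1m.
by split=> //=; rewrite s1_out rcons_cat mkseqS.
Qed.

Lemma try_cellP n k s (u := vars s var_u) (v := vars s var_v)
    (grows := (arrs s owners (u * n + v) == vars s var_key)
              && (arrs s labels u != arrs s labels v)) :
    ready n k s -> u < n -> v < n ->
  (forall t, arrs (sem try_cell s) marks t =
     if grows && ((t == u * n + v) || (t == v * n + u)) then 1
     else arrs s marks t)
  /\ (forall w, w < n -> arrs (sem try_cell s) labels w =
     if grows && (arrs s labels w == arrs s labels v) then arrs s labels u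
     else arrs s labels w).
Proof.
move=> s_ready lt_un lt_vn; rewrite /try_cell 2!sem_If eval_same eval_differ.
have [_ _ sr] := s_ready; rewrite [eval s (Elt owners _)]/= -/u -/v sr //.
rewrite [eval s (Var _)]/= [eval s (Elt _ _)]/= [eval s (Elt labels (Var 3))]/=.
rewrite -/u -/v /grows; case: eqP => // _; case: eqP => // _.
have s1_ready : ready n k (sem link_cell s) by apply: ready_sem.
split=> [t|w lt_wn].
  transitivity (arrs (sem link_cell s) marks t).
    have eq_marks := @arrs_sem marks relabel (sem link_cell s) isT.
    by rewrite -eq_marks.
  rewrite /= -/u -/v !sr //.
  by case: (t == v * n + u); case: (t == u * n + v).
exact: (relabelP s1_ready).
Qed.

(** * Greedy growth inside one class of edges *)

Section Grow.

Variables (n k : nat) (X : {set {set 'I_n}}).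
Implicit Types (F M : {set {set 'I_n}}) (s : state).

Definition labels_of F s : Prop :=
  forall x y : 'I_n, (arrs s labels x == arrs s labels y) = connect (adj F) x y.

Definition marks_of M s : Prop :=
  forall x y : 'I_n, arrs s marks (x * n + y) = adj M x y.

(** Two sets evolve together: the labels follow the forest [F] of the current graph, the marks
    follow the union [M] of everything chosen so far. *)
Lemma grow_cellsP F M s :
    ready n k s ->
    (forall x y : 'I_n,
       (arrs s owners (x * n + y) == vars s var_key) = adj X x y) ->
    acyclic F -> F \subset M -> labels_of F s -> marks_of M s ->
  exists F', [/\ F \subset F' & F' \subset F :|: X] /\
    [/\ acyclic F', forall x y, adj X x y -> connect (adj F') x y,
      labels_of F' (sem (for_cells try_cell) s)
    & marks_of (M :|: F') (sem (for_cells try_cell) s)].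
Proof.
move=> s_ready so acF sFM sF sM.
pose J t s1 := [/\ vars s1 var_key = vars s var_key,
   arrs s1 owners = arrs s owners &
   exists F', [/\ F \subset F' & F' \subset F :|: X] /\
    [/\ acyclic F',
       forall x y : 'I_n, x * n + y < t -> adj X x y -> connect (adj F') x y,
       labels_of F' s1 & marks_of (M :|: F') s1]].
suff [_ _ [F' [sFF' [acF' conF' s'F s'M]]]] :
  J (n * n) (sem (for_cells try_cell) s).
  exists F'; split=> //; split=> // x y; apply: conF'.
  by have := ltn_ord x; have := ltn_ord y; nia.
apply: for_cells_ind s_ready _ => //; last first.
  split=> //; exists F; split; split; rewrite ?subsetUl //.
  by rewrite (setUidPl sFM).
move=> u v s1 lt_un lt_vn s1u s1v s1_ready [s1key s1o [F' [[sFF' sF'X]]]].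
move=> [acF' conF' s1F s1M].
pose x := Ordinal lt_un; pose y := Ordinal lt_vn.
have := try_cellP s1_ready; rewrite s1u s1v => /(_ lt_un lt_vn).
rewrite s1o s1key (so x y) (s1F x y); set c := _ && _ => -[s2m s2l].
split; rewrite ?vars_sem ?arrs_sem //.
have before_t (x' y' : 'I_n) : x' * n + y' < (u * n + v).+1 =
    (x' * n + y' < u * n + v) || (x' == x) && (y' == y).
  rewrite ltnS leq_eqVlt orbC; congr (_ || _).
  exact: (index_inj x' u (ltn_ord y') lt_vn).
(* When nothing is added, the cell is outside [X] or its ends are connected already. *)
have [c_true|c_false] := boolP c; last first.
  exists F'; split=> //; split=> //.
  - move=> x' y'; rewrite before_t => /orP[lt_t|/andP[/eqP-> /eqP->]].
      exact: conF'.
    by move=> Xxy; move: c_false; rewrite /c Xxy negbK.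
  - by move=> x' y'; rewrite !s2l // (negPf c_false); apply: s1F.
  - by move=> x' y'; rewrite s2m (negPf c_false); apply: s1M.
have /andP[Xxy nxy] := c_true.
exists ([set x; y] |: F'); split; split.
- exact: subset_trans sFF' (subsetUr _ _).
- by rewrite subUset sF'X andbT sub1set in_setU [_ \in X]Xxy orbT.
- exact: acyclicU1.
- move=> x' y'; rewrite before_t => /orP[lt_t Xx'y'|/andP[/eqP-> /eqP->] _].
    exact: connect_adjS (subsetUr _ _) (conF' _ _ lt_t Xx'y').
  by rewrite connect1 // /adj setU11.
- move=> x' y'; rewrite !s2l // c_true /=.
  exact: (connect_adjU1 x y (f := fun z : 'I_n => arrs s1 labels z) s1F).
- move=> x' y'; rewrite s2m c_true s1M.
  rewrite (index_inj x' u (ltn_ord y') lt_vn).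
  rewrite (index_inj x' v (ltn_ord y') lt_un).
  rewrite {2}/adj setUCA in_setU1 eq_set2 /=.
  by case: ifP => // _; case: (adj _ _ _).
Qed.

Lemma growP F M e s :
    ready n k s ->
    (forall x y : 'I_n, (arrs s owners (x * n + y) == eval s e) = adj X x y) ->
    acyclic F -> F \subset M -> labels_of F s -> marks_of M s ->
  exists F', [/\ F \subset F' & F' \subset F :|: X] /\
    [/\ acyclic F', forall x y, adj X x y -> connect (adj F') x y,
      labels_of F' (sem (grow e) s) & marks_of (M :|: F') (sem (grow e) s)].
Proof.
move=> s_ready; apply: (@grow_cellsP F M (set_var var_key (eval s e) s)).
by case: s_ready.
Qed.

End Grow.

(** * Correctness *)

Lemma nth_allpairs (S T R : Type) (f : S -> T -> R) z x y s t i j :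
  i < size s -> j < size t ->
  nth z [seq f a b | a <- s, b <- t] (i * size t + j) =
    f (nth x s i) (nth y t j).
Proof.
elim: s i => //= a s IHs [|i] lt_i lt_j.
  by rewrite nth_cat size_map lt_j (nth_map y).
by rewrite nth_cat size_map mulSn -addnA ltnNge leq_addr addKn IHs.
Qed.

Lemma size_encode_edges n (F : {set {set 'I_n}}) :
  size (encode_edges F) = n * n.
Proof. by rewrite size_allpairs size_enum_ord. Qed.

Lemma nth_encode_edges n (F : {set {set 'I_n}}) (x y : 'I_n) :
  nth 0 (encode_edges F) (x * n + y) = adj F x y.
Proof.
have := @nth_allpairs _ _ _ (fun u v => adj F u v : nat) 0 x y
  (enum 'I_n) (enum 'I_n) x y.
by rewrite size_enum_ord !nth_ord_enum; apply.
Qed.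

Lemma encode_edges_mkseq n (F : {set {set 'I_n}}) (f : nat -> nat) :
  (forall x y : 'I_n, f (x * n + y) = adj F x y) ->
  mkseq f (n * n) = encode_edges F.
Proof.
move=> fF; apply: (@eq_from_nth _ 0).
  by rewrite size_mkseq size_encode_edges.
move=> t; rewrite size_mkseq => lt_t; rewrite nth_mkseq //.
have n_gt0 : 0 < n by case: (n) lt_t.
have lt_tn : t %/ n < n by rewrite ltn_divLR.
have lt_tm : t %% n < n by rewrite ltn_mod.
rewrite (divn_eq t n).
by rewrite (fF (Ordinal lt_tn) (Ordinal lt_tm)) -nth_encode_edges.
Qed.

Lemma connect_adj0 (T : finType) (x y : T) :
  connect (adj set0) x y = (x == y).
Proof.
apply/connectP/eqP => [[[|z p] //= /andP[]]|->]; last by exists [::].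
by rewrite /adj in_set0.
Qed.

(** * From edge classes to simultaneous spanning trees *)

Section Solve.

Variable x : graph_family.
Let n := nverts x.
Let k := ngraphs x.
Let E (i : 'I_k) : {set {set 'I_n}} := edges (graphs i).

Definition shared_edges : {set {set 'I_n}} :=
  [set e | [exists i : 'I_k, exists j : 'I_k,
              [&& i < j, e \in E i & e \in E j]]].

Local Notation S := shared_edges.
Implicit Types F M : {set {set 'I_n}}.

Hypothesis x_sunflower : sunflower x.

Lemma sharedP e :
  reflect (exists i j, [/\ i != j, e \in E i & e \in E j]) (e \in S).
Proof.
rewrite inE; apply: (iffP existsP) => [[i /existsP[j /and3P[ij ei ej]]]|].
  by exists i, j; rewrite neq_ltn ij.
move=> [i [j []]]; rewrite neq_ltn => /orP[ij|ij] ei ej.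
  by exists i; apply/existsP; exists j; rewrite ij ei.
by exists j; apply/existsP; exists i; rewrite ij ei ej.
Qed.

(** An edge of two graphs has both ends in the common vertex set, so it belongs to the common
    induced subgraph, all of whose edges lie in every graph. *)
Lemma shared_sub i : S \subset E i.
Proof.
have [G [GV GE]] := x_sunflower.
apply/subsetP => e /sharedP[j [l [jl ej el]]].
have : e \in edges G.
  have [_ ->] := GE j; rewrite inE ej -(GV _ _ jl) subsetI.
  by have [-> _] := edgesP ej; have [-> _] := edgesP el.
by have [_ ->] := GE i; rewrite inE => /andP[].
Qed.

Lemma exclusive_disjoint i j e : i != j -> e \in E i :\: S -> e \notin E j.
Proof.
move=> ij /setDP[ei]; apply: contra => ej.
by apply/sharedP; exists i, j.
Qed.

(* Forests grown by the first [m] iterations: on the later graphs the chosen set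
   is still the spanning forest [F] of the shared edges. *)
Definition grown (F M : {set {set 'I_n}}) (m : nat) : Prop :=
  [/\ F \subset M, M \subset \bigcup_i E i,
      forall i : 'I_k, m <= i -> M :&: E i = F
    & forall i : 'I_k, i < m -> acyclic (M :&: E i) /\
        forall u v, adj (E i) u v -> connect (adj (M :&: E i)) u v].

(** What [F'] adds to [F] belongs to the graph [i] alone, so the traces on the other graphs do not
    change; on the graph [i] the old trace [F] is absorbed by [F']. *)
Lemma grown_step F M F' (i : 'I_k) :
    F \subset S -> (forall u v, adj S u v -> connect (adj F) u v) ->
    grown F M i -> F \subset F' -> F' \subset F :|: (E i :\: S) ->
    acyclic F' ->
    (forall u v, adj (E i :\: S) u v -> connect (adj F') u v) ->
  grown F (M :|: F') i.+1.
Proof.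
move=> sFS conF [sFM sME later earlier] sFF' sF' acF' conF'.
have sFE j : F \subset E j := subset_trans sFS (shared_sub j).
have sF'E : F' \subset E i.
  by apply: subset_trans sF' _; rewrite subUset sFE subsetDl.
have MF'i : (M :|: F') :&: E i = F'.
  by rewrite setIUl later // (setIidPl sF'E); apply/setUidPr.
have MF'j j : i != j -> (M :|: F') :&: E j = M :&: E j.
  move=> ij; rewrite setIUl; apply/setUidPl.
  apply/subsetP => e /setIP[/(subsetP sF')/setUP[eF|eX] ej].
    by rewrite inE (subsetP sFM).
  by rewrite (negPf (exclusive_disjoint ij eX)) in ej.
split.
- exact: subset_trans sFM (subsetUl _ _).
- by rewrite subUset sME (subset_trans sF'E (bigcup_sup i _)).
- move=> j lt_ij; rewrite MF'j ?later // 1?ltnW //.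
  by rewrite -val_eqE /= ltn_eqF.
move=> j; rewrite ltnS leq_eqVlt => /predU1P[/val_inj->|lt_ji].
  (* The ends of a shared edge are connected by [F] already, those of an exclusive edge by the
     growth in this round. *)
  rewrite MF'i; split=> // u v uv; have [uvS|uvS] := boolP (adj S u v).
    exact: connect_adjS sFF' (conF _ _ uvS).
  by apply: conF'; rewrite /adj inE; apply/andP.
rewrite MF'j; first exact: earlier.
by rewrite -val_eqE /= gtn_eqF.
Qed.

Lemma grown_solution F M : grown F M k -> @simultaneous_spanning_tree x M.
Proof.
move=> [_ sME _ grownM]; split=> // i; have [acM conM] := grownM i (ltn_ord i).
split=> // [|F' sF'E acF' sMF']; first exact: subsetIr.
apply: acyclic_maximal conM sF'E acF' sMF' => e.
by case/edgesP.
Qed.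

Let w := flatten [seq encode_graph (graphs i) | i <- enum 'I_k].

(** Stated on bare numbers to fit [owner]; out-of-range graph numbers give [false]. *)
Let edge_in (t j : nat) : bool :=
  if insub j is Some i then 0 < nth 0 (encode_edges (E i)) t else false.

Lemma edge_inE (u v : 'I_n) (i : 'I_k) : edge_in (u * n + v) i = adj (E i) u v.
Proof.
rewrite /edge_in valK nth_encode_edges.
by case: adj.
Qed.

Lemma owner_eq_shared (u v : 'I_n) :
  (owner k (edge_in (u * n + v)) k == k.+1) = adj S u v.
Proof.
apply/owner_shared/sharedP => // [[i [j [ij jk ei ej]]]|[i [j [ij ei ej]]]].
  have ik := ltn_trans ij jk; exists (Ordinal ik), (Ordinal jk).
  by rewrite -val_eqE /= ltn_eqF //; split=> //; rewrite -/(adj _ _ _) -edge_inE.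
have [lt_ij|lt_ji|/val_inj eq_ij] := ltngtP i j.
- by exists i, j; rewrite !edge_inE.
- by exists j, i; rewrite !edge_inE.
- by rewrite eq_ij eqxx in ij.
Qed.

Lemma owner_eq_exclusive (u v : 'I_n) (i : 'I_k) :
  (owner k (edge_in (u * n + v)) k == i.+1) = adj (E i :\: S) u v.
Proof.
rewrite owner_exclusive // edge_inE owner_eq_shared.
by rewrite /adj in_setD andbC.
Qed.

Lemma solveP : exists2 M, @simultaneous_spanning_tree x M &
  outbuf (sem solve (start n k w)) = 1 :: encode_edges M.
Proof.
pose s1 := sem fill_rows (start n k w).
have s1_ready : ready n k s1 := fill_rowsP n k w.
pose s2 := sem read_graphs s1; have s2_ready : ready n k s2 by apply: ready_sem.
have s2_owner t : t < n * n -> arrs s2 owners t = owner k (edge_in t) k.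
  pose h i := if insub i is Some i' then
    [seq nat_of_bool (v \in vertices (graphs i')) | v <- enum 'I_n] else [::].
  pose g i := if insub i is Some i' then encode_edges (E i') else [::].
  apply: (read_graphsP (h := h) (g := g)) => // [i lt_ik|i lt_ik|i t' lt_ik _||t'].
  - by rewrite /h insubT size_map size_enum_ord.
  - by rewrite /g insubT size_encode_edges.
  - by rewrite /edge_in /g insubT.
  - rewrite /s1 inbuf_sem //= /w -val_enum_ord -map_comp; congr flatten.
    by apply: eq_map => i /=; rewrite /h /g valK.
  - by rewrite /s1 arrs_sem.
pose s3 := sem (For var_w var_n (Put labels (Var var_w) (Var var_w))) s2.
have s3_ready : ready n k s3 by apply: ready_sem.
have s3_labels : labels_of (set0 : {set {set 'I_n}}) s3.
  by move=> u v; rewrite connect_adj0 !(@fillP n k labels _ id).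
have s3_marks : marks_of (set0 : {set {set 'I_n}}) s3.
  by move=> u v; rewrite /s3 /s2 /s1 !arrs_sem //= /adj in_set0.
have [|F] := @growP n k S set0 set0 (Plus (Var var_k) (Cst 1)) s3 s3_ready _
  (@acyclic0 _) (sub0set _) s3_labels s3_marks.
  move=> u v; have [_ s3k _] := s3_ready.
  rewrite /= s3k addn1 /s3 arrs_sem // s2_owner ?owner_eq_shared //.
  by have := ltn_ord u; have := ltn_ord v; nia.
rewrite !set0U; set s4 := sem (grow _) s3.
move=> [[_ sFS] [acF conF s4_labels s4_marks]].
have s4_ready : ready n k s4 by apply: ready_sem.
pose s5 := sem (copy labels saved) s4.
pose grow_graph := Seq (copy saved labels) (grow (Plus (Var var_i) (Cst 1))).
(* [labels] is absent from the invariant, as each round restores it from [saved]. *)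
pose I i s := [/\ ready n k s, arrs s owners = arrs s2 owners,
  arrs s saved = arrs s5 saved & exists2 M, marks_of M s & grown F M i].
pose s6 := sem (For var_i var_k grow_graph) s5.
have s5_ready : ready n k s5 by apply: ready_sem.
have [s6_ready _ _ [M s6_marks grownM]] : I k s6; last first.
  exists M; first exact: grown_solution grownM.
  have -> : sem solve (start n k w) = sem emit_marks s6 by [].
  rewrite (emit_marksP s6_ready) (encode_edges_mkseq s6_marks).
  by rewrite /s6 !outbuf_sem.
have [_ s5k _] := s5_ready; rewrite -[k in I k]s5k.
apply: (sem_For_ind (I := I)) => //.
  have owners_s5 : arrs s5 owners = arrs s2 owners.
    by rewrite /s5 arrs_sem // /s4 arrs_sem // /s3 arrs_sem.
  split=> //; exists F; first by move=> u v; rewrite /= arrs_sem.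
  split=> // [|i _].
    apply/subsetP => e /(subsetP sFS)/sharedP[i [_ [_ ei _]]].
    by apply/bigcupP; exists i.
  by apply/setIidPl; apply: subset_trans sFS (shared_sub i).
rewrite s5k => j s lt_jk sj [s_ready s_owners s_saved [M sM grownM]].
pose i := Ordinal lt_jk; pose s' := sem (copy saved labels) s.
have s'_ready : ready n k s' by apply: ready_sem.
(* The round starts from the shared forest, whatever earlier rounds have added to [M]. *)
have s'_labels : labels_of F s'.
  move=> u v; rewrite -s4_labels !(copyP _ s_ready) // s_saved.
  by rewrite !(copyP _ s4_ready).
have s'_marks : marks_of M s' by move=> u v; rewrite arrs_sem.
have sFM : F \subset M by case: grownM.
have [|F' [[sFF' sF'X] [acF' conF' _ s''_marks]]] := @growP n k (E i :\: S) F M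
  (Plus (Var var_i) (Cst 1)) s' s'_ready _ acF sFM s'_labels s'_marks.
  move=> u v; rewrite /s' arrs_sem // s_owners s2_owner; last first.
    by have := ltn_ord u; have := ltn_ord v; nia.
  rewrite (_ : eval s' _ = i.+1) ?owner_eq_exclusive //.
  by rewrite [LHS]addn1 vars_sem ?sj.
have s''_ready : ready n k (sem grow_graph s) by apply: ready_sem.
have arrs_s'' a : ~~ puts a grow_graph ->
    arrs (set_var var_i j.+1 (sem grow_graph s)) a = arrs s a.
  by move=> ?; rewrite -(@arrs_sem a grow_graph s).
split; rewrite ?arrs_s'' //.
exists (M :|: F') => //.
exact: (grown_step (i := i) sFS conF grownM sFF' sF'X acF' conF').
Qed.

End Solve.

Lemma empty_family_solution (x : graph_family) :
  nverts x = 0 -> @simultaneous_spanning_tree x set0.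
Proof.
move=> n0; have no_edge (G : graph 'I_(nverts x)) : edges G = set0.
  apply/setP => e; rewrite in_set0; apply/negP => /edgesP[_ e2].
  by have := max_card e; rewrite e2 card_ord n0.
split=> [|i]; first exact: sub0set.
split; rewrite ?no_edge ?setI0 ?sub0set //; first exact: acyclic0.
by move=> F'; rewrite subset0 => /eqP.
Qed.

Lemma bit_size_ge_size (w : seq nat) : size w <= bit_size w.
Proof.
by rewrite -sum1_size; apply: leq_sum => j _.
Qed.

Lemma size_encode_family (x : graph_family) :
  size (encode_family x) = (ngraphs x * (nverts x + nverts x * nverts x)).+2.
Proof.
rewrite /= size_flatten /shape -map_comp; congr _.+2.
rewrite (@eq_map _ _ _ (fun=> nverts x + nverts x * nverts x)) => [|i /=].
  by rewrite sumnE big_map big_enum /= sum_nat_const card_ord.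
by rewrite size_cat size_map size_enum_ord size_encode_edges.
Qed.

Theorem theorem2 : solvable_in_polynomial_time SST.
Proof.
exists (guarded solve), (time solve + 6%N%:P)%R => x [k_gt0 x_sunflower].
set m := bit_size _.
have size_m : (ngraphs x * (nverts x + nverts x * nverts x)).+2 <= m.
  by rewrite -size_encode_family bit_size_ge_size.
(* There is at least one graph, so its matrix alone has at least [nverts x] entries; when there are
   vertices, each graph contributes at least one word. *)
have n_m : nverts x <= m by nia.
have k_m : 0 < nverts x -> ngraphs x <= m by nia.
have := guardedP
  (flatten [seq encode_graph (graphs i) | i <- enum 'I_(ngraphs x)])
  solve_ok n_m k_m.
rewrite (hornerD (time solve)) hornerC.
case: eqP => [n0|_] halts; eexists; split; try exact: halts.
  (* Without vertices the matrix of the empty edge set is the empty word, so the answer [[:: 1]] is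
     a solution. *)
  left; exists set0; split; first exact: empty_family_solution.
  congr (_ :: _); apply/esym/size0nil.
  by rewrite size_encode_edges n0.
by have [M M_sol ->] := solveP x_sunflower; left; exists M.
Qed.
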